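(* Let $k$ be a field and $G$ a finite group. Let $X$ be a set of representatives of the conjugacy classes of $G$. Compute $HH^*(kG)$ by the normalized cochain complex $\mathcal{H}^*=\mathrm{Map}(\overline{G}^{\times *},kG)=\bigoplus_{x\in X}\mathcal{H}_x^*$ and, for $x\in X$, compute $H^*(C_G(x),k)$ by the normalized cochain complex $\mathrm{Map}(\overline{C_G(x)}^{\times *},k)$. Then an isomorphism of graded vector spaces (the additive decomposition) $$HH^*(kG)\xrightarrow{\ \sim\ }\bigoplus_{x\in X}H^*(C_G(x),k)$$ is realized as follows: for $x\in X$, the class $[\varphi_x]$ of a cocycle $\varphi_x\in\mathcal{H}_x^n$ is sent to the class $[\widehat\varphi_x]\in H^n(C_G(x),k)$ of $\widehat\varphi_x:\overline{C_G(x)}^{\times n}\to k$, where $\widehat\varphi_x(h_1,\dots,h_n)$ is the coefficient of $x$ in $$\varphi_x(h_1,\dots,h_n)h_n^{-1}\cdots h_1^{-1}\in kC_x .$$ The inverse isomorphism sends the class of a cocycle $\widehat\varphi_x:\overline{C_G(x)}^{\times n}\to k$ to the class of $\varphi_x\in\mathcal{H}_x^n$ given by $$\varphi_x(g_1,\dots,g_n)=\sum_{i=1}^{n_x}\widehat\varphi_x(h_{i,1},\dots,h_{i,n})\,x_i\,g_1\cdots g_n ,$$ where $h_{i,1},\dots,h_{i,n}\in C_G(x)$ are determined by the sequence $g_1,\dots,g_n$ through $$\gamma_{i,x}g_1=h_{i,1}\gamma_{s_i^1,x},\quad \gamma_{s_i^1,x}g_2=h_{i,2}\gamma_{s_i^2,x},\quad\dots,\quad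 \gamma_{s_i^{n-1},x}g_n=h_{i,n}\gamma_{s_i^n,x}.$$
   Context: For a group $H$ write $\overline{H}=H\setminus\{1\}$. For a $k$-vector space $V$, $\mathrm{Map}(\overline{H}^{\times n},V)$ denotes all maps of sets, identified with $\mathrm{Hom}_k((kH/k\cdot 1)^{\otimes n},V)$ (and with $V$ for $n=0$); accordingly, in every formula such a map takes the value $0$ whenever one of its arguments equals $1$. Hochschild cohomology: $HH^*(kG)$ is the cohomology of $\mathcal{H}^n=\mathrm{Map}(\overline{G}^{\times n},kG)$ with differential $\delta_0(a)(g)=ga-ag$ and $$\delta_n(\varphi)(g_1,\dots,g_{n+1})=g_1\varphi(g_2,\dots,g_{n+1})+\sum_{i=1}^n(-1)^i\varphi(g_1,\dots,g_ig_{i+1},\dots,g_{n+1})+(-1)^{n+1}\varphi(g_1,\dots,g_n)g_{n+1}.$$ Group cohomology: for a finite group $H$, $H^*(H,k)$ (trivial coefficients) is the cohomology of $\mathrm{Map}(\overline{H}^{\times n},k)$ with $$\delta_n(\psi)(h_1,\dots,h_{n+1})=\psi(h_2,\dots,h_{n+1})+\sum_{i=1}^n(-1)^i\psi(h_1,\dots,h_ih_{i+1},\dots,h_{n+1})+(-1)^{n+1}\psi(h_1,\dots,h_n).$$ For $x\in X$: $C_x$ is the conjugacy class of $x$, $C_G(x)$ the centralizer of $x$, $n_x=|C_x|=[G:C_G(x)]$; fix right coset representatives $\gamma_{1,x}=1,\gamma_{2,x},\dots,\gamma_{n_x,x}$, so that $G=\bigsqcup_{i=1}^{n_x}C_G(x)\gamma_{i,x}$,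 and put $x_i=\gamma_{i,x}^{-1}x\gamma_{i,x}$, so $C_x=\{x_1=x,x_2,\dots,x_{n_x}\}$. Since the cosets are disjoint, for $g\in G$ and $1\le i\le n_x$ the equation $\gamma_{i,x}g=h\gamma_{s,x}$ determines $h\in C_G(x)$ and the index $s$ uniquely. For $x\in X$, $\mathcal{H}_x^0=kC_x$ and, for $n\ge1$, $\mathcal{H}_x^n$ is the space of maps $\varphi:\overline{G}^{\times n}\to kG$ such that $\varphi(g_1,\dots,g_n)$ lies in the $k$-span $k[g_1\cdots g_nC_x]$ of the set $g_1\cdots g_nC_x$ for all $g_1,\dots,g_n\in\overline{G}$. It is known (Cibils–Solotar) that $\mathcal{H}_x^*$ is a subcomplex of $\mathcal{H}^*$ and $\mathcal{H}^*=\bigoplus_{x\in X}\mathcal{H}_x^*$. *)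

(* Defs.v *)
From HB Require Import structures.
From mathcomp Require Import all_boot all_order all_fingroup all_algebra.

Set Implicit Arguments.
Unset Strict Implicit.
Unset Printing Implicit Defensive.

Import GRing.Theory.
Local Open Scope ring_scope.

(* The element [a] of kG has coefficient [a g] at [g]. *)
Definition galg (k : fieldType) (gT : finGroupType) : Type := {ffun gT -> k^o}.

HB.instance Definition _ k gT := Choice.on (galg k gT).
HB.instance Definition _ k gT := Vector.on (galg k gT).

Section GroupAlgebra.
Variables (k : fieldType) (gT : finGroupType).
Implicit Types (a b c : galg k gT) (g h : gT).

Definition gbasis g : galg k gT := [ffun u => (u == g)%:R].

Definition galg_mul a b : galg k gT :=
  [ffun u => \sum_v a v * b (v^-1 * u)%g].

Lemma galg_mulA : associative galg_mul.
Proof.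
move=> a b c; apply/ffunP=> u; rewrite !ffunE.
under eq_bigr do rewrite ffunE mulr_sumr.
under [RHS]eq_bigr do rewrite ffunE mulr_suml.
rewrite [RHS]exchange_big; apply: eq_bigr => v _ /=.
rewrite (reindex_inj (mulgI v^-1%g)) /=; apply: eq_bigr => w _.
by rewrite mulrA invMg invgK -!mulgA mulKVg.
Qed.

Lemma galg_mul1 : left_id (gbasis 1%g) galg_mul.
Proof.
move=> a; apply/ffunP=> u; rewrite !ffunE (bigD1 1%g) //= !ffunE eqxx mul1r.
rewrite invg1 mul1g big1 ?addr0 // => v /negPf nv.
by rewrite ffunE nv mul0r.
Qed.

Lemma galg_mulr1 : right_id (gbasis 1%g) galg_mul.
Proof.
move=> a; apply/ffunP=> u; rewrite !ffunE (bigD1 u) //= !ffunE mulVg eqxx.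
rewrite mulr1 big1 ?addr0 // => v /negPf nv; rewrite ffunE.
by rewrite -eq_invg_mul invgK nv mulr0.
Qed.

Lemma galg_mulDl : left_distributive galg_mul +%R.
Proof.
move=> a b c; apply/ffunP=> u; rewrite !ffunE -big_split.
by apply: eq_bigr => v _; rewrite !ffunE mulrDl.
Qed.

Lemma galg_mulDr : right_distributive galg_mul +%R.
Proof.
move=> a b c; apply/ffunP=> u; rewrite !ffunE -big_split.
by apply: eq_bigr => v _; rewrite !ffunE mulrDr.
Qed.

Lemma galg_oner_neq0 : gbasis 1%g != 0.
Proof.
by apply/eqP => /ffunP /(_ 1%g) /eqP; rewrite !ffunE eqxx oner_eq0.
Qed.

HB.instance Definition _ := GRing.Zmodule_isNzRing.Build (galg k gT)
  galg_mulA galg_mul1 galg_mulr1 galg_mulDl galg_mulDr galg_oner_neq0.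

Lemma galg_scaleAl (c : k) a b : c *: (a * b) = (c *: a) * b.
Proof.
apply/ffunP=> u; rewrite !ffunE scaler_sumr; apply: eq_bigr => v _.
by rewrite !ffunE scalerAl.
Qed.

HB.instance Definition _ :=
  GRing.Lmodule_isLalgebra.Build k (galg k gT) galg_scaleAl.

Lemma galg_scaleAr (c : k) a b : c *: (a * b) = a * (c *: b).
Proof.
apply/ffunP=> u; rewrite !ffunE scaler_sumr; apply: eq_bigr => v _.
by rewrite !ffunE scalerAr.
Qed.

HB.instance Definition _ :=
  GRing.Lalgebra_isAlgebra.Build k (galg k gT) galg_scaleAr.

Definition kspan (S : {set gT}) : {vspace galg k gT} :=
  <<[seq gbasis u | u in S]>>%VS.

Lemma gbasisE g u : gbasis g u = (u == g)%:R.
Proof. by rewrite ffunE. Qed.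

Lemma gbasisM g h : gbasis (g * h)%g = gbasis g * gbasis h.
Proof.
apply/ffunP=> u; rewrite !ffunE (bigD1 g) //= !ffunE eqxx mul1r.
rewrite big1 ?addr0 => [|v /negPf nv]; last by rewrite ffunE nv mul0r.
by rewrite (canF_eq (mulKVg g)).
Qed.

Lemma galg_sum_basis a : a = \sum_g a g *: gbasis g.
Proof.
apply/ffunP=> u; rewrite sum_ffunE (bigD1 u) //= !ffunE eqxx.
rewrite big1 ?addr0 => [|v nv]; first by rewrite /GRing.scale /= mulr1.
by rewrite !ffunE eq_sym (negPf nv) scaler0.
Qed.

Lemma kspanP (S : {set gT}) a :
  reflect (forall u, u \notin S -> a u = 0) (a \in kspan S).
Proof.
apply: (iffP idP) => [|h0].
  move=> /coord_span -> u nu; rewrite sum_ffunE big1 // => i _.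
  have lti: (i < size [seq gbasis u | u in S])%N by rewrite size_image.
  have /imageP[v vS ->] := mem_nth 0 lti.
  rewrite !ffunE; case: eqP => [e|_]; last by rewrite scaler0.
  by rewrite e vS in nu.
rewrite (galg_sum_basis a) memv_suml // => g _.
have [gS|/h0 ->] := boolP (g \in S); last by rewrite scale0r mem0v.
by rewrite memvZ // memv_span // image_f.
Qed.

Lemma gbasisMl g a u : (gbasis g * a) u = a (g^-1 * u)%g.
Proof.
rewrite ffunE (bigD1 g) //= !ffunE eqxx mul1r big1 ?addr0 // => v /negPf nv.
by rewrite ffunE nv mul0r.
Qed.

Lemma gbasisMr g a u : (a * gbasis g) u = a (u * g^-1)%g.
Proof.
rewrite ffunE (bigD1 (u * g^-1)%g) //= !ffunE invMg invgK mulgKV eqxx mulr1.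
rewrite big1 ?addr0 // => v /negPf nv; rewrite ffunE.
rewrite -(inj_eq (mulgI v)) mulKVg -(inj_eq (mulIg g^-1%g)) mulgK eq_sym.
by rewrite nv mulr0.
Qed.

End GroupAlgebra.

Section Subquotient.
Variables (k : fieldType) (V : vectType k) (Z B : {vspace V}).

Definition in_bnd : {pred subvs_of Z} := [pred z | vsval z \in B].

Lemma in_bnd_zmod_closed : zmod_closed in_bnd.
Proof.
split=> [|u v]; rewrite !inE ?linear0 ?mem0v // linearB.
exact: memvB.
Qed.

HB.instance Definition _ := GRing.isZmodClosed.Build _ in_bnd in_bnd_zmod_closed.

(* Z / (Z :&: B), i.e. Z / B when B is contained in Z. *)
Definition subquot : Type := Quotient.quot in_bnd.
HB.instance Definition _ := GRing.Zmodule.on subquot.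

Definition subquot_pi (z : subvs_of Z) : subquot :=
  \pi_(Quotient.quot in_bnd)%qT z.

Definition subquot_scale (c : k) (x : subquot) : subquot :=
  subquot_pi (c *: generic_quotient.repr (x : Quotient.quot in_bnd)).

Lemma subquot_piP (u v : subvs_of Z) :
  reflect (subquot_pi u = subquot_pi v) (vsval u - vsval v \in B).
Proof.
rewrite -linearB -[_ \in B]/(u - v \in in_bnd) Quotient.idealrBE.
exact: eqP.
Qed.

Lemma subquot_pi_surj (x : subquot) : exists z, x = subquot_pi z.
Proof. by exists (generic_quotient.repr (x : Quotient.quot in_bnd)); rewrite /subquot_pi reprK. Qed.

Lemma subquot_piD u v : subquot_pi (u + v) = subquot_pi u + subquot_pi v.
Proof. by rewrite /subquot_pi piE. Qed.

Lemma subquot_piZ c u : subquot_pi (c *: u) = subquot_scale c (subquot_pi u).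
Proof.
apply/subquot_piP; rewrite -linearB -scalerBr linearZ memvZ // linearB.
by apply/subquot_piP; rewrite /subquot_pi reprK.
Qed.

Lemma subquot_scaleA a b x :
  subquot_scale a (subquot_scale b x) = subquot_scale (a * b) x.
Proof.
by have [z ->] := subquot_pi_surj x; rewrite -!subquot_piZ scalerA.
Qed.

Lemma subquot_scale1 : left_id 1 subquot_scale.
Proof.
by move=> x; have [z ->] := subquot_pi_surj x; rewrite -!subquot_piZ scale1r.
Qed.

Lemma subquot_scaleDr : right_distributive subquot_scale +%R.
Proof.
move=> a x y; have [u ->] := subquot_pi_surj x.
have [v ->] := subquot_pi_surj y.
by rewrite -subquot_piD -!subquot_piZ scalerDr subquot_piD.
Qed.

Lemma subquot_scaleDl x : {morph subquot_scale^~ x : a b / a + b}.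
Proof.
move=> a b; have [u ->] := subquot_pi_surj x.
by rewrite -!subquot_piZ scalerDl subquot_piD.
Qed.

HB.instance Definition _ := GRing.Zmodule_isLmodule.Build k subquot
  subquot_scaleA subquot_scale1 subquot_scaleDr subquot_scaleDl.

Lemma subquot_pi_linear : linear subquot_pi.
Proof. by move=> c u v; rewrite subquot_piD subquot_piZ. Qed.

HB.instance Definition _ :=
  GRing.isLinear.Build k (subvs_of Z) subquot _ subquot_pi subquot_pi_linear.

(* The class of v; only meaningful for v \in Z ([vsproj] is then the identity,
   see [vsprojK]). *)
Definition cls (v : V) : subquot := subquot_pi (vsproj Z v).

Lemma cls_eq u v : u \in Z -> v \in Z -> (cls u = cls v) <-> (u - v \in B).
Proof.
by move=> uZ vZ; split=> [/subquot_piP|h]; [|apply/subquot_piP];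
  rewrite !vsprojK.
Qed.

End Subquotient.

Section DirectSum.
Variables (k : fieldType) (I : finType) (V : I -> lmodType k).

Definition dsum : Type := {dffun forall i, V i}.
HB.instance Definition _ := Choice.on dsum.
Implicit Types f g h : dsum.

Definition dsum_add f g : dsum := [ffun i => f i + g i].
Definition dsum_opp f : dsum := [ffun i => - f i].
Definition dsum_zero : dsum := [ffun i => 0].
Definition dsum_scale (c : k) f : dsum := [ffun i => c *: f i].

Lemma dsum_addA : associative dsum_add.
Proof. by move=> f g h; apply/ffunP=> i; rewrite !ffunE addrA. Qed.
Lemma dsum_addC : commutative dsum_add.
Proof. by move=> f g; apply/ffunP=> i; rewrite !ffunE addrC. Qed.
Lemma dsum_add0 : left_id dsum_zero dsum_add.
Proof. by move=> f; apply/ffunP=> i; rewrite !ffunE add0r. Qed.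
Lemma dsum_addN : left_inverse dsum_zero dsum_opp dsum_add.
Proof. by move=> f; apply/ffunP=> i; rewrite !ffunE addNr. Qed.

HB.instance Definition _ :=
  GRing.isZmodule.Build dsum dsum_addA dsum_addC dsum_add0 dsum_addN.

Lemma dsum_scaleA a b f : dsum_scale a (dsum_scale b f) = dsum_scale (a * b) f.
Proof. by apply/ffunP=> i; rewrite !ffunE scalerA. Qed.
Lemma dsum_scale1 : left_id 1 dsum_scale.
Proof. by move=> f; apply/ffunP=> i; rewrite !ffunE scale1r. Qed.
Lemma dsum_scaleDr : right_distributive dsum_scale +%R.
Proof. by move=> a f g; apply/ffunP=> i; rewrite !ffunE scalerDr. Qed.
Lemma dsum_scaleDl f : {morph dsum_scale^~ f : a b / a + b}.
Proof. by move=> a b; apply/ffunP=> i; rewrite !ffunE scalerDl. Qed.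

HB.instance Definition _ := GRing.Zmodule_isLmodule.Build k dsum
  dsum_scaleA dsum_scale1 dsum_scaleDr dsum_scaleDl.

Definition dsum_inj (i : I) (v : V i) : dsum :=
  finfun (dfwith (fun j => 0 : V j) v).

End DirectSum.

Section Cohomology.
Variables (k : fieldType) (C : nat -> vectType k).
Variable d : forall n, 'Hom(C n, C n.+1).

Definition cocycles n : {vspace C n} := lker (d n).

Definition coboundaries n : {vspace C n} :=
  match n with 0 => 0%VS | m.+1 => limg (d m) end.

Definition cohomology n := subquot (cocycles n) (coboundaries n).

End Cohomology.

Section Cochains.
Variables (k : fieldType) (aT : finGroupType) (V : vectType k).

Definition nbar n := {t : n.-tuple aT | 1%g \notin t}.

Definition cochain n := {ffun nbar n -> V}.

(* Value at an arbitrary tuple: 0 as soon as one argument is 1. *)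
Definition ev n (phi : cochain n) (t : n.-tuple aT) : V :=
  if insub t is Some u then phi u else 0.

Lemma ev_linear n (t : n.-tuple aT) : linear (fun phi : cochain n => ev phi t).
Proof.
move=> c f g; rewrite /ev; case: insub => [u|]; first by rewrite !ffunE.
by rewrite scaler0 addr0.
Qed.

End Cochains.

Section Faces.
Variables (aT : finGroupType) (n : nat).
Implicit Type t : n.+1.-tuple aT.

Definition wid (j : 'I_n) : 'I_n.+1 := widen_ord (leqnSn n) j.
Definition suc (j : 'I_n) : 'I_n.+1 := lift ord0 j.

(* (g_2, ..., g_{n+1}) and (g_1, ..., g_n) *)
Definition face_first t : n.-tuple aT := [tuple tnth t (suc j) | j < n].
Definition face_last t : n.-tuple aT := [tuple tnth t (wid j) | j < n].

(* (g_1, ..., g_i g_{i+1}, ..., g_{n+1}), where the ordinal [i] counts from 0 *)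
Definition face_mul (i : 'I_n) t : n.-tuple aT :=
  [tuple if (j < i)%N then tnth t (wid j)
         else if j == i then (tnth t (wid j) * tnth t (suc j))%g
         else tnth t (suc j) | j < n].

Lemma prod_face_first t :
  (\prod_(g <- t) g = tnth t ord0 * \prod_(g <- face_first t) g)%g.
Proof.
rewrite !big_tuple big_ord_recl; congr (_ * _)%g.
by apply: eq_bigr => i _; rewrite tnth_mktuple.
Qed.

Lemma prod_face_last t :
  (\prod_(g <- t) g = \prod_(g <- face_last t) g * tnth t ord_max)%g.
Proof.
rewrite !big_tuple big_ord_recr; congr (_ * _)%g.
by apply: eq_bigr => i _; rewrite tnth_mktuple.
Qed.

Lemma prod_face_mul i t : (\prod_(g <- face_mul i t) g = \prod_(g <- t) g)%g.
Proof.
pose f j := nth 1%g t j.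
pose F j := if (j < i)%N then f j else if j == i then (f j * f j.+1)%g
            else f j.+1.
have tf m : (\prod_(j < m) F j = \prod_(j < m + (i < m)) f j)%g.
  elim: m => [|m IH]; first by rewrite !big_ord0.
  rewrite big_ord_recr IH /= /F [(i < m.+1)%N]ltnS.
  case: (ltngtP m i) => [_|_|->] /=; rewrite ?addn1 ?addn0 ?big_ord_recr //=.
  by rewrite mulgA.
rewrite !big_tuple; transitivity (\prod_(j < n) F j)%g.
  apply: eq_bigr => j _; rewrite tnth_mktuple !(tnth_nth 1%g) /= /bump.
  by rewrite leq0n add1n.
by rewrite tf ltn_ord addn1; apply: eq_bigr => j _; rewrite (tnth_nth 1%g).
Qed.

End Faces.

Section Hochschild.
Variables (k : fieldType) (gT : finGroupType).
Local Notation kG := (galg k gT).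
Local Notation C := (@cochain k gT kG).

Definition hoch_diff_fun n (phi : C n) : C n.+1 :=
  [ffun u : nbar gT n.+1 => let t := val u in
     gbasis k (tnth t ord0) * ev phi (face_first t)
     + \sum_(i < n) (-1) ^+ i.+1 *: ev phi (face_mul i t)
     + (-1) ^+ n.+1 *: (ev phi (face_last t) * gbasis k (tnth t ord_max))].

Lemma hoch_diff_linear n : linear (@hoch_diff_fun n).
Proof.
move=> c f g; apply/ffunP=> u; rewrite !ffunE /= !ev_linear.
under eq_bigr do rewrite ev_linear scalerDr scalerA mulrC -scalerA.
rewrite big_split /= -scaler_sumr mulrDl mulrDr !scalerDr -scalerAr -scalerAl.
rewrite [in X in _ + X = _]scalerA [(-1) ^+ n.+1 * c]mulrC -scalerA.
by rewrite [RHS]addrACA; congr (_ + _); rewrite addrACA.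
Qed.

HB.instance Definition _ n :=
  GRing.isLinear.Build k (C n) (C n.+1) _ (@hoch_diff_fun n)
    (@hoch_diff_linear n).

Definition hoch_diff n : 'Hom(C n, C n.+1) := linfun (@hoch_diff_fun n).

(* The summand H_x^n; for n = 0 the product is 1 and this is k C_x. That these
   are subcomplexes with direct sum H^* when x runs over representatives of
   the classes is [hoch_part_diff], [hoch_comp_sum] and [hoch_part_indep]. *)
Definition hoch_part (x : gT) n : {pred C n} :=
  [pred phi : C n | [forall u : nbar gT n,
     phi u \in kspan k ((\prod_(g <- val u) g)%g *: (x ^: [set: gT]))%g]].
Arguments hoch_part x n : clear implicits.

Lemma hoch_partP x n (phi : C n) :
  reflect (forall (t : n.-tuple gT) u,
             ((\prod_(g <- t) g)^-1 * u)%g \notin (x ^: [set: gT])%g ->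
             ev phi t u = 0)
          (phi \in hoch_part x n).
Proof.
apply: (iffP forallP) => h.
  move=> t u hu; rewrite /ev; case: insubP => [v _ vt|_]; last by rewrite ffunE.
  by have /kspanP -> := h v => //; rewrite mem_lcoset vt.
move=> v; apply/kspanP => u; rewrite mem_lcoset => /h.
by rewrite /ev valK.
Qed.

Lemma class_setTJ (x u g : gT) :
  ((u ^ g)%g \in (x ^: [set: gT])%g) = (u \in (x ^: [set: gT])%g).
Proof. by rewrite class_sym classGidl ?inE // class_sym. Qed.

Lemma hoch_part_diff x n (phi : C n) :
  phi \in hoch_part x n -> hoch_diff n phi \in hoch_part x n.+1.
Proof.
move=> /hoch_partP h; apply/forallP => v; apply/kspanP => u.
rewrite mem_lcoset => hu.
have addE (a b : kG) w : (a + b) w = a w + b w by rewrite ffunE.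
have scaleE (c : k) (a : kG) w : (c *: a) w = c *: a w by rewrite ffunE.
rewrite lfunE ffunE /= !addE scaleE gbasisMl gbasisMr sum_ffunE.
rewrite h ?add0r; last by rewrite mulgA -invMg -prod_face_first.
rewrite big1 ?add0r => [|i _]; last first.
  by rewrite scaleE h ?scaler0 // prod_face_mul.
rewrite h ?scaler0 //; apply: contra hu.
rewrite (prod_face_last (val v)) invMg.
set b := (\prod_(g <- face_last _) g)%g; set c := tnth _ _ => hu.
have -> : (c^-1 * b^-1 * u = (b^-1 * (u * c^-1)) ^ c)%g.
  by rewrite conjgE !mulgA mulgKV.
by rewrite class_setTJ.
Qed.

Definition hoch_comp (x : gT) n (phi : C n) : C n :=
  [ffun t : nbar gT n => [ffun u =>
     if ((\prod_(g <- val t) g)^-1 * u)%g \in (x ^: [set: gT])%g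
     then phi t u else 0] : kG].

Lemma hoch_comp_part x n phi : hoch_comp x phi \in hoch_part x n.
Proof.
apply/forallP => v; apply/kspanP => u; rewrite mem_lcoset !ffunE.
by move=> /negPf ->.
Qed.

Section Representatives.
Variable X : {set gT}.
Hypothesis hX : is_transversal X (classes [set: gT]) [set: gT].

Lemma class_repP (u : gT) : exists2 x, x \in X &
  {in X, forall y, (u \in (y ^: [set: gT])%g) = (y == x)}.
Proof.
case/and3P: hX => _ _ /forall_inP /(_ (u ^: [set: gT])%g).
rewrite mem_classes ?inE // => /(_ isT) /cards1P [x /setP eX].
exists x => [|y yX].
  by have := eX x; rewrite !inE eqxx => /andP[].
by have := eX y; rewrite !inE yX /= class_sym.
Qed.

Lemma hoch_comp_sum n (phi : C n) : phi = \sum_(x in X) hoch_comp x phi.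
Proof.
apply/ffunP=> t; rewrite sum_ffunE; apply/ffunP=> u; rewrite sum_ffunE.
have [x xX hx] := class_repP ((\prod_(g <- val t) g)^-1 * u)%g.
rewrite (bigD1 x) //= !ffunE hx // eqxx big1 ?addr0 // => y /andP[yX /negPf nyx].
by rewrite !ffunE hx // nyx.
Qed.

Lemma hoch_part_indep n (f : gT -> C n) :
  (forall x, x \in X -> f x \in hoch_part x n) ->
  \sum_(x in X) f x = 0 -> forall x, x \in X -> f x = 0.
Proof.
move=> hf h0 x xX; apply/ffunP=> t; rewrite ffunE; apply/ffunP=> u.
rewrite ffunE; have [y yX hy] := class_repP ((\prod_(g <- val t) g)^-1 * u)%g.
have fz z : z \in X -> z != y -> f z t u = 0.
  move=> zX nzy; have /forallP /(_ t) /kspanP := hf z zX; apply.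
  by rewrite mem_lcoset hy.
have [->|nxy] := eqVneq x y; last exact: fz.
have := congr1 (fun w : C n => w t u) h0; rewrite sum_ffunE sum_ffunE !ffunE.
by rewrite (bigD1 y) //= big1 ?addr0 // => z /andP[zX nzy]; exact: fz.
Qed.

End Representatives.

End Hochschild.
Arguments hoch_diff : clear implicits.
Arguments hoch_part k {gT} x n.

Section GroupCohomology.
Variables (k : fieldType) (aT : finGroupType).
Local Notation C := (@cochain k aT k^o).

Definition grp_diff_fun n (psi : C n) : C n.+1 :=
  [ffun u : nbar aT n.+1 => let t := val u in
     ev psi (face_first t)
     + \sum_(i < n) (-1) ^+ i.+1 * ev psi (face_mul i t)
     + (-1) ^+ n.+1 * ev psi (face_last t)].

Lemma grp_diff_linear n : linear (@grp_diff_fun n).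
Proof.
move=> c f g; apply/ffunP=> u; rewrite !ffunE /= !ev_linear.
under eq_bigr do rewrite ev_linear mulrDr -scalerAr.
rewrite big_split /= -scaler_sumr mulrDr -scalerAr !scalerDr.
by rewrite [RHS]addrACA; congr (_ + _); rewrite addrACA.
Qed.

HB.instance Definition _ n :=
  GRing.isLinear.Build k (C n) (C n.+1) _ (@grp_diff_fun n)
    (@grp_diff_linear n).

Definition grp_diff n : 'Hom(C n, C n.+1) := linfun (@grp_diff_fun n).

End GroupCohomology.
Arguments grp_diff : clear implicits.

Definition HH k gT n := cohomology (hoch_diff k gT) n.
Definition Hgrp k aT n := cohomology (grp_diff k aT) n.

Definition HH_class (k : fieldType) (gT : finGroupType) n (phi : cochain gT (galg k gT) n) : HH k gT n :=
  cls (cocycles (hoch_diff k gT) n) (coboundaries (hoch_diff k gT) n) phi.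
Definition Hgrp_class (k : fieldType) (aT : finGroupType) n (psi : cochain aT k^o n) :
    Hgrp k aT n :=
  cls (cocycles (grp_diff k aT) n) (coboundaries (grp_diff k aT) n) psi.

Notation cent x := (subg_of 'C[x]%G).

Section Comparison.
Variables (k : fieldType) (gT : finGroupType).
Local Notation nconj x := #|(x ^: [set: gT])%g|.
Local Notation kG := (galg k gT).

(* The indices run over 0, ..., n_x - 1, so that the representative of the
   trivial coset is [gam 0]. *)
Definition right_coset_reps (x : gT) (gam : 'I_(nconj x) -> gT) : Prop :=
  (forall i : 'I_(nconj x), val i = 0%N -> gam i = 1%g)
  /\ (forall g : gT, exists! i : 'I_(nconj x), g \in ('C[x] :* gam i)%g).

Section Centralizer.
Variables (x : gT) (gam : 'I_(nconj x) -> gT).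

(* The unique h and s such that gam i * g = h * gam s; see [coset_stepP] and
   [coset_step_uniq]. *)
Definition coset_idx (i : 'I_(nconj x)) (g : gT) : 'I_(nconj x) :=
  odflt i [pick s | (gam i * g)%g \in ('C[x] :* gam s)%g].

Definition coset_cent (i : 'I_(nconj x)) (g : gT) : cent x :=
  subg 'C[x] (gam i * g * (gam (coset_idx i g))^-1)%g.

Lemma coset_stepP i g : right_coset_reps gam ->
  (gam i * g = val (coset_cent i g) * gam (coset_idx i g))%g.
Proof.
case=> _ /(_ (gam i * g)%g) [s [hs _]]; rewrite /coset_cent.
suff hC : (gam i * g * (gam (coset_idx i g))^-1)%g \in 'C[x]%g.
  by rewrite /= subgK // mulgKV.
rewrite -mem_rcoset /coset_idx; case: pickP => //= none.
by rewrite none in hs.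
Qed.

Lemma coset_step_uniq i g (h : cent x) s : right_coset_reps gam ->
  (gam i * g = val h * gam s)%g -> h = coset_cent i g /\ s = coset_idx i g.
Proof.
move=> gamP e.
have e' := coset_stepP i g gamP.
have es : s = coset_idx i g.
  case: gamP => _ /(_ (gam i * g)%g) [s0 [_ us0]].
  apply: etrans (us0 (coset_idx i g) _); first apply/esym/us0.
    by rewrite mem_rcoset e mulgK (valP h).
  by rewrite mem_rcoset e' mulgK (valP (coset_cent i g)).
split=> //; apply: val_inj; apply: (mulIg (gam s)).
by rewrite -e e' -es.
Qed.

(* From i and (g_1, ..., g_n) to (h_{i,1}, ..., h_{i,n}). *)
Fixpoint coset_cents (i : 'I_(nconj x)) (gs : seq gT) : seq (cent x) :=
  if gs is g :: gs' then coset_cent i g :: coset_cents (coset_idx i g) gs'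
  else [::].

Lemma size_coset_cents i n (t : n.-tuple gT) : size (coset_cents i t) == n.
Proof.
apply/eqP; rewrite -[RHS](size_tuple t).
by elim: (tval t) i => //= g gs IH i; rewrite IH.
Qed.

Definition coset_cents_tuple i n (t : n.-tuple gT) : n.-tuple (cent x) :=
  Tuple (size_coset_cents i t).

Definition to_hoch n (psi : cochain (cent x) k^o n) : cochain gT kG n :=
  [ffun u => \sum_(i < nconj x)
     ev psi (coset_cents_tuple i (val u)) *:
       gbasis k (x ^ gam i * \prod_(g <- val u) g)%g].

End Centralizer.

(* phi(h_1, ..., h_n) h_n^-1 ... h_1^-1 *)
Definition untwist (x : gT) n (phi : cochain gT kG n)
    (t : n.-tuple (cent x)) : kG :=
  ev phi [tuple of map val t] *
    gbasis k (\prod_(h <- rev (val t)) (val h)^-1)%g.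

Definition to_grp (x : gT) n (phi : cochain gT kG n) :
    cochain (cent x) k^o n :=
  [ffun u => untwist phi (val u) x].

End Comparison.

(* Main.v *)
(* Reading off the coefficient of u in phi(g_1, ..., g_n) g_n^-1 ... g_1^-1
   identifies the Hochschild complex with the k-valued cochains of the action
   groupoid of G acting on itself by conjugation. The component of x is a
   connected groupoid with vertex group C_G(x); [to_grp] is restriction along the
   inclusion of C_G(x), and [to_hoch] is pullback along the retraction given by
   the coset representatives. Their composite on C_G(x)-cochains is the
   identity because gam 0 = 1. The other composite is homotopic to the identity:
   the elements gam i form a natural transformation, whose chain homotopy is
     (K F)(i; g_1, ..., g_n) =
       sum_j (-1)^j F(0; h_1, ..., h_j, gam s_j, g_(j+1), ..., g_n). *)
Require Import Defs.
From HB Require Import structures.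
From mathcomp Require Import all_boot all_order all_fingroup all_algebra.
From mathcomp Require Import ring.

Set Implicit Arguments.
Unset Strict Implicit.
Unset Printing Implicit Defensive.

Import GRing.Theory.
Local Open Scope ring_scope.

(** * Classes in subquotients and the maps induced on them *)

Lemma subquot_cls_surj (k : fieldType) (V : vectType k) (Z B : {vspace V})
    (q : subquot Z B) :
  exists2 v, v \in Z & q = cls Z B v.
Proof.
have [z ->] := subquot_pi_surj q.
by exists (vsval z); rewrite /cls ?vsvalK // subvsP.
Qed.

Lemma cls_linear (k : fieldType) (V : vectType k) (Z B : {vspace V}) : linear (cls Z B).
Proof. by move=> c u v; rewrite /cls !linearP. Qed.

HB.instance Definition _ (k : fieldType) (V : vectType k) (Z B : {vspace V}) :=
  GRing.isLinear.Build k V (subquot Z B) _ (cls Z B) (@cls_linear k V Z B).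

Section SubquotMap.
Variables (k : fieldType) (V W : vectType k).
Variables (Z B : {vspace V}) (Z' B' : {vspace W}) (f : {linear V -> W}).
Hypotheses (fZ : {homo f : v / v \in Z >-> v \in Z'}).
Hypotheses (fB : {homo f : v / v \in B >-> v \in B'}).

(** Uses a chosen representative of the class; [fB] makes the result independent of the choice, see
    [subquot_map_cls]. *)
Definition subquot_map (q : subquot Z B) : subquot Z' B' :=
  cls Z' B' (f (vsval (generic_quotient.repr (q : Quotient.quot (in_bnd (Z:=Z) B))))).

Lemma subquot_map_cls v : v \in Z -> subquot_map (cls Z B v) = cls Z' B' (f v).
Proof.
move=> vZ; apply/cls_eq; rewrite ?fZ ?subvsP // -linearB fB //.
rewrite -[v in _ - v](vsprojK vZ); apply/subquot_piP.
by rewrite /subquot_pi reprK.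
Qed.

Lemma subquot_map_linear : linear subquot_map.
Proof.
move=> c p q; have [u uZ ->] := subquot_cls_surj p.
have [v vZ ->] := subquot_cls_surj q.
by rewrite -linearP !subquot_map_cls ?linearP // memvD // memvZ.
Qed.

End SubquotMap.

(** * Alternating sums of faces, by recursion on sequences *)

Section TailFaces.
Variables (aT : finGroupType) (k : fieldType).
Implicit Types (f : seq aT -> k) (s t : seq aT).

(* The faces of [g :: t] other than the first, with sign (-1)^i for the i-th one
   counted from 0 (see [tail_facesE]). On a sequence [:: g], [mul_head] is the
   last face. The recursion on [seq], rather than a sum over face indices, makes
   the homotopy identity [prism_tail_faces] a plain induction. *)
Definition mul_head g f t : k := if t is a :: t' then f ((g * a)%g :: t') else f [::].

Fixpoint tail_faces f s : k :=
  if s is g :: t then mul_head g f t - tail_faces (fun t => f (g :: t)) t else 0.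

Definition normalized f := forall s, 1%g \in s -> f s = 0.

Lemma eq_tail_faces f f' s :
  (forall t, (size t).+1 = size s -> f t = f' t) -> tail_faces f s = tail_faces f' s.
Proof.
elim: s f f' => //= g t IH f f' e.
rewrite (IH _ (fun t => f' (g :: t))) => [|t' st']; last by apply: e; rewrite /= st'.
by congr (_ - _); case: t e {IH} => [|a t] e; apply: e.
Qed.

Lemma tail_faces_sub f f' s :
  tail_faces (fun t => f t - f' t) s = tail_faces f s - tail_faces f' s.
Proof.
elim: s f f' => [|g t IH] f f' /=; first by rewrite subr0.
rewrite IH; have -> : mul_head g (fun t => f t - f' t) t =
  mul_head g f t - mul_head g f' t by case: t {IH}.
by ring.
Qed.

Lemma tail_faces0 s : tail_faces (fun=> 0) s = 0.
Proof. by elim: s => //= g [|a t] -> /=; rewrite subr0. Qed.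

Lemma normalized_cons f g : normalized f -> normalized (fun t => f (g :: t)).
Proof. by move=> fN s s1; apply: fN; rewrite inE s1 orbT. Qed.

(** Multiplying the leading 1 into its neighbour gives back [t], while every later face keeps the 1
    and vanishes. *)
Lemma tail_faces1 f t : normalized f -> tail_faces f (1%g :: t) = f t.
Proof.
move=> fN /=; rewrite (@eq_tail_faces _ (fun=> 0)) => [|s _]; last first.
  by apply: fN; rewrite inE eqxx.
by rewrite tail_faces0 subr0; case: t => //= a t; rewrite mul1g.
Qed.

(** The two faces that absorb the 1 are equal and carry opposite signs; every other face still
    contains a 1. *)
Lemma tail_faces_degenerate f g t :
  normalized f -> 1%g \in t -> tail_faces f (g :: t) = 0.
Proof.
elim: t f g => // a t IH f g fN; rewrite inE => /predU1P[<-|t1].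
  by rewrite [LHS]/= -/(tail_faces _ (1%g :: t)) tail_faces1 ?mulg1 ?subrr //;
    apply: normalized_cons.
rewrite [LHS]/= -/(tail_faces _ (a :: t)) IH //; last exact: normalized_cons.
by rewrite fN ?subr0 // inE t1 orbT.
Qed.

Lemma face_mul_cons0 n g (t : n.+1.-tuple aT) :
  face_mul ord0 [tuple of g :: t] = [tuple of (g * thead t)%g :: behead t].
Proof.
case/tupleP: t => a t; apply: eq_from_tnth => -[[|i] lti];
  by rewrite tnth_mktuple !(tnth_nth 1%g).
Qed.

Lemma face_mul_consS n g (t : n.+1.-tuple aT) (i : 'I_n) :
  face_mul (lift ord0 i) [tuple of g :: t] = [tuple of g :: face_mul i t].
Proof.
apply: eq_from_tnth => -[[|j] ltj]; first by rewrite tnth_mktuple !(tnth_nth 1%g).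
have ltj' : (j < n)%N by [].
have -> : Ordinal ltj = lift ord0 (Ordinal ltj') by apply: val_inj.
by rewrite tnthS !tnth_mktuple !(tnth_nth 1%g) -!val_eqE.
Qed.

Lemma face_last_cons n g (t : n.+1.-tuple aT) :
  face_last [tuple of g :: t] = [tuple of g :: face_last t].
Proof.
apply: eq_from_tnth => -[[|j] ltj]; first by rewrite tnth_mktuple !(tnth_nth 1%g).
have ltj' : (j < n)%N by [].
have -> : Ordinal ltj = lift ord0 (Ordinal ltj') by apply: val_inj.
by rewrite tnthS !tnth_mktuple !(tnth_nth 1%g).
Qed.

Lemma face_first_cons n g (t : n.-tuple aT) : face_first [tuple of g :: t] = t.
Proof. by apply: eq_from_tnth => i; rewrite tnth_mktuple !(tnth_nth 1%g). Qed.

(** Peeling off the head shifts each remaining face index by one, which is the sign in the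
    recursion. *)
Lemma tail_facesE n f (t : n.+1.-tuple aT) :
  tail_faces f t = - (\sum_(i < n) (-1) ^+ i.+1 * f (face_mul i t)
                      + (-1) ^+ n.+1 * f (face_last t)).
Proof.
elim: n f t => [|n IH] f t; case/tupleP: t => g t.
  by rewrite tuple0 (tuple0 (face_last _)) big_ord0 /= subr0; ring.
rewrite big_ord_recl face_mul_cons0 face_last_cons.
under eq_bigr do rewrite face_mul_consS lift0 exprS -mulrA.
rewrite -mulr_sumr [LHS]/= IH.
have -> : mul_head g f t = f ((g * thead t)%g :: behead t).
  by case/tupleP: t => a t; rewrite theadE.
by rewrite [(-1) ^+ n.+2]exprS; ring.
Qed.

End TailFaces.

(** * Both differentials in terms of values on sequences *)

Section SeqEv.
Variables (k : fieldType) (aT : finGroupType) (V : vectType k) (n : nat).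
Implicit Types (phi : cochain aT V n) (s : seq aT).

(* Junk value 0 when [size s != n]. *)
Definition seq_ev phi s : V :=
  if insub s is Some t then ev phi (t : n.-tuple aT) else 0.

Lemma seq_evE phi (t : n.-tuple aT) : seq_ev phi t = ev phi t.
Proof. by rewrite /seq_ev valK. Qed.

Lemma ev_nbar phi (u : nbar aT n) : ev phi (val u) = phi u.
Proof. by rewrite /ev valK. Qed.

Lemma seq_ev_degenerate phi s : 1%g \in s -> seq_ev phi s = 0.
Proof.
move=> s1; rewrite /seq_ev; case: insubP => // t _ ts.
by rewrite /ev insubF //; apply/negP; rewrite memtE -[tval t]/(val t) ts s1.
Qed.

Lemma seq_ev_inj phi phi' :
  (forall s, size s = n -> seq_ev phi s = seq_ev phi' s) -> phi = phi'.
Proof.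
move=> e; apply/ffunP => t.
by have := e (val t) (size_tuple _); rewrite !seq_evE !ev_nbar.
Qed.

End SeqEv.

Section GroupCochains.
Variables (k : fieldType) (aT : finGroupType) (n : nat).
Implicit Type psi : cochain aT k^o n.

(** Holds at degenerate sequences too: there the left side is 0 by convention and the faces on the
    right cancel. *)
Lemma grp_diff_seq_ev psi g t : size t = n ->
  seq_ev (grp_diff k aT n psi) (g :: t) =
  seq_ev psi t - tail_faces (seq_ev psi : seq aT -> k) (g :: t).
Proof.
move=> /eqP st; pose t' := Tuple st; pose gt := [tuple of g :: t'].
have psiN : normalized (seq_ev psi : seq aT -> k) := @seq_ev_degenerate _ _ _ _ psi.
rewrite -[g :: t]/(tval gt) -[t]/(tval t') [LHS]seq_evE lfunE.
have [gt1|ngt1] := boolP (1%g \in tval gt).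
  rewrite -seq_evE seq_ev_degenerate //; move: gt1; rewrite inE => /predU1P[g1|t1].
    by rewrite [tval gt]/= -g1 tail_faces1 ?subrr.
  by rewrite tail_faces_degenerate // psiN // subr0.
rewrite -[gt]/(val (Sub gt ngt1 : nbar aT n.+1)) ev_nbar ffunE; cbv zeta.
rewrite -[val (Sub gt ngt1 : nbar aT n.+1)]/gt.
rewrite tail_facesE opprK (face_first_cons g t') -addrA seq_evE.
by congr (_ + (_ + _ * _)); [apply: eq_bigr => i _; congr (_ * _)|]; rewrite seq_evE.
Qed.

End GroupCochains.

Section HochschildCochains.
Variables (k : fieldType) (gT : finGroupType).
Local Notation C := (cochain gT (galg k gT)).

(* The coefficient of u in phi(s) s_n^-1 ... s_1^-1. In these coordinates a
   Hochschild cochain is a k-valued cochain of the action groupoid of G acting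
   on itself by conjugation. *)
Definition hcoef n (phi : C n) (u : gT) (s : seq gT) : k :=
  seq_ev phi s (u * \prod_(g <- s) g)%g.

Lemma hcoef_normalized n (phi : C n) u : normalized (hcoef phi u).
Proof. by move=> s s1; rewrite /hcoef seq_ev_degenerate // ffunE. Qed.

Lemma hcoef_linear n u s : linear (fun phi : C n => hcoef phi u s : k^o).
Proof.
move=> c a b; rewrite /hcoef /seq_ev; case: insub => [t|].
  by rewrite ev_linear !ffunE.
by rewrite ffunE scaler0 addr0.
Qed.

Lemma hcoefB n (a b : C n) u s : hcoef (a - b) u s = hcoef a u s - hcoef b u s.
Proof. by rewrite addrC -scaleN1r hcoef_linear scaleN1r addrC. Qed.

Lemma hcoef0 n u s : hcoef (0 : C n) u s = 0.
Proof. by rewrite -(subrr 0) hcoefB subrr. Qed.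

Lemma hcoef_sum n (I : finType) (F : I -> C n) u s :
  hcoef (\sum_i F i) u s = \sum_i hcoef (F i) u s.
Proof.
apply: (big_morph (fun a => hcoef a u s)) => [a b|]; last exact: hcoef0.
by rewrite -[a]scale1r hcoef_linear !scale1r.
Qed.

Lemma hcoef_inj n (phi phi' : C n) :
  (forall u s, size s = n -> hcoef phi u s = hcoef phi' u s) -> phi = phi'.
Proof.
move=> e; apply/ffunP => t; apply/ffunP => u.
have := e (u * (\prod_(g <- val t) g)^-1)%g (val t) (size_tuple _).
by rewrite /hcoef mulgKV !seq_evE !ev_nbar.
Qed.

(** Left multiplication by the first argument conjugates the base point [u], and right
    multiplication by the last is absorbed in the product. Hence only the first face moves [u]. *)
Lemma hcoef_diff n (phi : C n) u g t : size t = n ->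
  hcoef (hoch_diff k gT n phi) u (g :: t) =
  hcoef phi (u ^ g)%g t - tail_faces (hcoef phi u) (g :: t).
Proof.
move=> /eqP st; pose t' := Tuple st; pose gt := [tuple of g :: t'].
rewrite -[g :: t]/(tval gt) -[t]/(tval t').
have [gt1|ngt1] := boolP (1%g \in tval gt).
  rewrite hcoef_normalized //; move: gt1; rewrite inE => /predU1P[g1|t1].
    by rewrite [tval gt]/= -g1 tail_faces1 ?conjg1 ?subrr //; apply: hcoef_normalized.
  by rewrite tail_faces_degenerate ?hcoef_normalized ?subr0 //; apply: hcoef_normalized.
have addE (a b : galg k gT) w : (a + b) w = a w + b w by rewrite ffunE.
have scaleE (c : k) (a : galg k gT) w : (c *: a) w = c * a w by rewrite ffunE.
rewrite {1}/hcoef seq_evE lfunE.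
rewrite -[gt in ev _ gt]/(val (Sub gt ngt1 : nbar gT n.+1)) ev_nbar ffunE; cbv zeta.
rewrite -[val (Sub gt ngt1 : nbar gT n.+1)]/gt.
rewrite !addE scaleE gbasisMl gbasisMr sum_ffunE (face_first_cons g t').
rewrite tail_facesE opprK -addrA; congr (_ + (_ + _ * _)).
- by rewrite /hcoef seq_evE big_cons conjgE !mulgA.
- by apply: eq_bigr => i _; rewrite scaleE /hcoef seq_evE prod_face_mul.
- by rewrite /hcoef seq_evE prod_face_last !mulgA mulgK.
Qed.

(** The translate [u * p] equals [p * u ^ p], and the class of [x] is stable under conjugation. *)
Lemma hcoef_part (x : gT) n (phi : C n) u s : phi \in hoch_part k x n ->
  u \notin (x ^: [set: gT])%g -> hcoef phi u s = 0.
Proof.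
move=> /hoch_partP phix ux; rewrite /hcoef /seq_ev.
case: insubP => [t _ ts|_]; last by rewrite ffunE.
by rewrite phix // ts -conjgE class_setTJ.
Qed.

End HochschildCochains.

(** * The retraction of the conjugation groupoid onto C_G(x) and its prism homotopy *)

Section Prism.
Variables (k : fieldType) (gT : finGroupType) (x : gT).
Variable gam : 'I_#|(x ^: [set: gT])%g| -> gT.
Hypothesis gamP : right_coset_reps gam.
Implicit Types (f : seq gT -> k) (i : 'I_#|(x ^: [set: gT])%g|).

(** The factor of [gam i * g] in the centralizer fixes [x], so [coset_idx] names the endpoint of the
    arrow [g] starting at [x ^ gam i]. *)
Lemma conj_coset_idx i g : (x ^ gam (coset_idx gam i g) = (x ^ gam i) ^ g)%g.
Proof.
rewrite -conjgM (coset_stepP i g gamP) conjgM; congr (_ ^ _)%g.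
by rewrite conjgE -(cent1P (valP (coset_cent gam i g))) mulKg.
Qed.

Lemma conj_rep_inj : injective (fun i => x ^ gam i)%g.
Proof.
move=> i j e; case: gamP => _ /(_ (gam i)) [l [_ ul]].
rewrite -(ul i) ?rcoset_refl //; apply: ul.
rewrite mem_rcoset; apply/cent1P/commute_sym/commgP/conjg_fixP.
by rewrite conjgM e conjgK.
Qed.

Lemma conj_rep_surj u : u \in (x ^: [set: gT])%g -> exists i, u = (x ^ gam i)%g.
Proof.
case/imsetP => g _ ->; case: gamP => _ /(_ g) [i [hi _]]; exists i.
case/rcosetP: hi => c /cent1P cx ->.
by rewrite conjgM; congr (_ ^ _)%g; rewrite conjgE -cx mulKg.
Qed.

Lemma conj_rep_class i : (x ^ gam i)%g \in (x ^: [set: gT])%g.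
Proof. by rewrite memJ_class ?inE. Qed.

(** Functoriality of the retraction, from uniqueness of the coset factorization. *)
Lemma coset_stepM i g a :
  coset_cent gam i (g * a)%g =
    (coset_cent gam i g * coset_cent gam (coset_idx gam i g) a)%g
  /\ coset_idx gam i (g * a)%g = coset_idx gam (coset_idx gam i g) a.
Proof.
have e : (gam i * (g * a) =
    val (coset_cent gam i g * coset_cent gam (coset_idx gam i g) a)%g *
    gam (coset_idx gam (coset_idx gam i g) a))%g.
  by rewrite mulgA (coset_stepP i g gamP) -mulgA (coset_stepP _ a gamP) mulgA.
by case: (coset_step_uniq gamP e).
Qed.

Lemma coset_step1 i : coset_cent gam i 1%g = 1%g /\ coset_idx gam i 1%g = i.
Proof.
have e : (gam i * 1 = val (1 : cent x) * gam i)%g by rewrite mulg1 mul1g.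
by case: (coset_step_uniq gamP e).
Qed.

Lemma coset_cents_degenerate i s : 1%g \in s -> 1%g \in coset_cents gam i s.
Proof.
elim: s i => //= g s IH i; rewrite !inE => /predU1P[<-|/IH->]; last by rewrite orbT.
by rewrite (coset_step1 i).1 eqxx.
Qed.

(* Chain homotopy given by the natural transformation with components gam i
   from the retraction of the groupoid onto C_G(x) to the identity. *)
Fixpoint prism f i s : k :=
  if s is g :: t then
    f [:: gam i, g & t]
    - prism (fun t => f (val (coset_cent gam i g) :: t)) (coset_idx gam i g) t
  else f [:: gam i].

Lemma eq_prism f f' i s :
  (forall t, size t = (size s).+1 -> f t = f' t) -> prism f i s = prism f' i s.
Proof.
elim: s f f' i => [|g t IH] f f' i e /=; first exact: e.
rewrite e // (IH _ (fun t => f' (val (coset_cent gam i g) :: t))) // => t' st'.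
by apply: e; rewrite /= st'.
Qed.

Lemma prism_sub f f' i s : prism (fun t => f t - f' t) i s = prism f i s - prism f' i s.
Proof. by elim: s f f' i => //= g t IH f f' i; rewrite IH; ring. Qed.

Lemma prism_normalized f i : normalized f -> normalized (prism f i).
Proof.
move=> fN s; elim: s f fN i => // g t IH f fN i /=; rewrite inE => s1.
rewrite fN ?inE ?s1 ?orbT // sub0r; apply/eqP; rewrite oppr_eq0; apply/eqP.
case/predU1P: s1 => [<-|t1]; last by apply: IH t1; apply: normalized_cons.
(* The centralizer part of 1 is 1, so [f1] is zero by normalization; replacing it by [f1 - f1] lets
   [prism_sub] annihilate its prism. *)
pose f1 t := f (val (coset_cent gam i 1%g) :: t).
rewrite (@eq_prism _ (fun t => f1 t - f1 t)) ?prism_sub ?subrr // => s _.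
by rewrite subrr (coset_step1 i).1 fN // inE eqxx.
Qed.

(** The homotopy identity without the first faces, which move the base point and enter only in
    [hcoef_cocycle]. By induction, the faces away from the head are the identity for [f] with [h]
    prepended. *)
Lemma prism_tail_faces f i s :
  prism (tail_faces f) i s + tail_faces (prism f i) s =
  f (map val (coset_cents gam i s)).
Proof.
elim: s f i => [|g t IH] f i; first by rewrite /= !subr0 addr0.
rewrite /= !tail_faces_sub !prism_sub.
set h := val (coset_cent gam i g); set j := coset_idx gam i g.
have {}IH := IH (fun t => f (h :: t)) j.
have -> : prism (tail_faces (fun t => f (h :: t))) j t =
    f (h :: map val (coset_cents gam j t)) - tail_faces (prism (fun t => f (h :: t)) j) t.
  by rewrite -IH; ring.
(* The terms at the head cancel by the naturality square [gam i * g = h * gam j], and for longer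
   sequences also by [coset_stepM]. *)
have : f ((gam i * g)%g :: t) - mul_head g (fun t => f (gam i :: t)) t
    = prism (mul_head h f) j t - mul_head g (prism f i) t.
  case: t {IH} => [|a t] /=.
    by rewrite (coset_stepP i g gamP) ; ring.
  rewrite (coset_stepP i g gamP) (coset_stepM i g a).1 (coset_stepM i g a).2 /=.
  by rewrite -/h -/j; ring.
by move=> /eqP; rewrite -subr_eq0 => /eqP e; apply: subr0_eq; rewrite -[RHS]e; ring.
Qed.

Lemma tail_faces_coset_cents (f : seq (cent x) -> k) i s :
  tail_faces (fun t => f (coset_cents gam i t)) s = tail_faces f (coset_cents gam i s).
Proof.
elim: s f i => //= g t IH f i; rewrite (IH (fun t => f (coset_cent gam i g :: t))).
congr (_ - _); case: t {IH} => //= a t.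
by rewrite (coset_stepM i g a).1 (coset_stepM i g a).2.
Qed.

(** Inverse to [hcoef] on the summand of [x], for normalized families indexed by the points of the
    class. It builds both [to_hoch] and the homotopy. *)
Definition assemble (F : 'I_#|(x ^: [set: gT])%g| -> seq gT -> k) n :
    cochain gT (galg k gT) n :=
  [ffun u : nbar gT n => \sum_i F i (val (val u)) *:
     gbasis k (x ^ gam i * \prod_(g <- val u) g)%g].

Lemma hcoef_assemble F n i s : size s = n -> normalized (F i) ->
  hcoef (assemble F n) (x ^ gam i)%g s = F i s.
Proof.
move=> /eqP sn FN; pose t := Tuple sn; rewrite -[s]/(tval t) /hcoef.
have [s1|s1] := boolP (1%g \in tval t); first by rewrite seq_ev_degenerate // ffunE FN.
rewrite seq_evE -[t in ev _ t]/(val (Sub t s1 : nbar gT n)) ev_nbar.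
rewrite ffunE sum_ffunE (bigD1 i) //= !ffunE eqxx big1 ?addr0 => [|j nji].
  by rewrite /GRing.scale /= mulr1.
rewrite !ffunE (inj_eq (mulIg _)) (inj_eq conj_rep_inj) eq_sym (negPf nji).
exact: scaler0.
Qed.

Lemma assemble_part F n : assemble F n \in hoch_part k x n.
Proof.
apply/forallP => u; rewrite ffunE rpred_sum // => i _; rewrite memvZ //.
apply/kspanP => w; rewrite mem_lcoset ffunE; case: eqP => // ->.
by rewrite -conjgE class_setTJ conj_rep_class.
Qed.

Lemma to_hochE n (psi : cochain (cent x) k^o n) :
  to_hoch gam psi = assemble (fun i s => seq_ev psi (coset_cents gam i s)) n.
Proof.
apply/ffunP => u; rewrite !ffunE; apply: eq_bigr => i _; congr (_ *: _).
by rewrite -seq_evE.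
Qed.

Lemma hcoef_to_hoch n (psi : cochain (cent x) k^o n) i s : size s = n ->
  hcoef (to_hoch gam psi) (x ^ gam i)%g s = seq_ev psi (coset_cents gam i s).
Proof.
move=> sn; rewrite to_hochE hcoef_assemble // => t t1.
by rewrite seq_ev_degenerate // coset_cents_degenerate.
Qed.

Lemma to_hoch_part n (psi : cochain (cent x) k^o n) : to_hoch gam psi \in hoch_part k x n.
Proof. by rewrite to_hochE assemble_part. Qed.

(** Pullback along a functor commutes with the differentials: [conj_coset_idx] treats the first
    face, [tail_faces_coset_cents] the others. Off the class of [x] both sides vanish. *)
Lemma hoch_diff_to_hoch n (psi : cochain (cent x) k^o n) :
  hoch_diff k gT n (to_hoch gam psi) = to_hoch gam (grp_diff k (cent x) n psi).
Proof.
apply: hcoef_inj => u [//|g t] [st].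
have [/conj_rep_surj [i ->]|nu] := boolP (u \in (x ^: [set: gT])%g); last first.
  by rewrite !(hcoef_part _ _ nu) ?hoch_part_diff ?to_hoch_part.
rewrite hcoef_to_hoch /= ?st // hcoef_diff // -conj_coset_idx hcoef_to_hoch //.
rewrite grp_diff_seq_ev; last by rewrite (eqP (size_coset_cents gam _ (in_tuple t))).
congr (_ - _); rewrite -(tail_faces_coset_cents _ i (g :: t)).
by apply: eq_tail_faces => t' [st']; rewrite hcoef_to_hoch // st' st.
Qed.

End Prism.

(** * Restriction to C_G(x), extension from it, and their composites *)

Section Restriction.
Variables (k : fieldType) (gT : finGroupType) (x : gT).
Local Notation C := (cochain gT (galg k gT)).

Lemma untwistE n (phi : C n) (t : n.-tuple (cent x)) u :
  untwist phi t u = hcoef phi u (map val t).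
Proof.
rewrite /untwist gbasisMr /hcoef -[map val t]/(tval [tuple of map val t]) seq_evE.
suff -> : (\prod_(h <- rev t) (val h)^-1 = (\prod_(g <- [tuple of map val t]) g)^-1)%g.
  by rewrite invgK.
rewrite /=; elim: (tval t) => [|h s IH]; first by rewrite !big_nil invg1.
by rewrite rev_cons -cats1 big_cat big_seq1 big_cons invMg IH.
Qed.

Lemma to_grpE n (phi : C n) u : to_grp x phi u = hcoef phi x (map val (val (val u))).
Proof. by rewrite ffunE; apply: untwistE. Qed.

Lemma seq_ev_to_grp n (phi : C n) (s : seq (cent x)) : size s = n ->
  seq_ev (to_grp x phi) s = hcoef phi x (map val s).
Proof.
move=> /eqP sn; pose t := Tuple sn; rewrite -[s]/(tval t) seq_evE.
have [t1|nt1] := boolP (1%g \in tval t).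
  rewrite -seq_evE seq_ev_degenerate // hcoef_normalized //.
  by apply/mapP; exists 1%g.
rewrite -[t in ev _ t]/(val (Sub t nt1 : nbar (cent x) n)) ev_nbar.
exact: to_grpE.
Qed.

Lemma to_grp_linear n : linear (@to_grp k gT x n).
Proof.
move=> c f g; apply/ffunP => u; rewrite to_grpE hcoef_linear -!to_grpE.
by rewrite [RHS]ffunE [X in _ = X + _]ffunE.
Qed.

HB.instance Definition _ n :=
  GRing.isLinear.Build k (C n) (cochain (cent x) k^o n) _ (@to_grp k gT x n)
    (@to_grp_linear n).

Lemma tail_faces_map_val (f : seq gT -> k) (s : seq (cent x)) :
  tail_faces (fun t : seq (cent x) => f (map val t)) s = tail_faces f (map val s).
Proof.
elim: s f => //= h t IH f; rewrite (IH (fun t => f (val h :: t))); congr (_ - _).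
by case: t {IH}.
Qed.

(** Elements of the centralizer fix [x], so the first face of the Hochschild differential stays at
    the base point [x]. *)
Lemma grp_diff_to_grp n (phi : C n) :
  grp_diff k (cent x) n (to_grp x phi) = to_grp x (hoch_diff k gT n phi).
Proof.
apply: seq_ev_inj => -[//|h t] [st].
rewrite grp_diff_seq_ev // [RHS]seq_ev_to_grp; last by rewrite /= st.
rewrite map_cons hcoef_diff ?size_map //.
have -> : (x ^ val h)%g = x by apply/conjg_fixP/commgP/commute_sym/cent1P/(valP h).
rewrite seq_ev_to_grp //; congr (_ - _); rewrite -(tail_faces_map_val _ (h :: t)).
apply: (@eq_tail_faces (cent x) k) => t' [st'].
by rewrite seq_ev_to_grp // st' st.
Qed.

Lemma to_grp_cocycle n (phi : C n) : phi \in cocycles (hoch_diff k gT) n ->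
  to_grp x phi \in cocycles (grp_diff k (cent x)) n.
Proof. by rewrite !memv_ker grp_diff_to_grp => /eqP->; rewrite linear0. Qed.

Lemma to_grp_coboundary n (phi : C n) : phi \in coboundaries (hoch_diff k gT) n ->
  to_grp x phi \in coboundaries (grp_diff k (cent x)) n.
Proof.
case: n phi => [|n] phi; first by rewrite !memv0 => /eqP->; rewrite linear0.
by case/memv_imgP => eta _ ->; rewrite -grp_diff_to_grp memv_img ?memvf.
Qed.

Variable gam : 'I_#|(x ^: [set: gT])%g| -> gT.

Lemma to_hoch_linear n : linear (@to_hoch k gT x gam n).
Proof.
move=> c f g; apply/ffunP => u; rewrite !ffunE scaler_sumr -big_split.
by apply: eq_bigr => i _; rewrite ev_linear scalerDl scalerA.
Qed.

HB.instance Definition _ n :=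
  GRing.isLinear.Build k (cochain (cent x) k^o n) (C n) _ (@to_hoch k gT x gam n)
    (@to_hoch_linear n).

Hypothesis gamP : right_coset_reps gam.

Lemma to_hoch_cocycle n psi : psi \in cocycles (grp_diff k (cent x)) n ->
  to_hoch gam psi \in cocycles (hoch_diff k gT) n.
Proof. by rewrite !memv_ker hoch_diff_to_hoch // => /eqP->; rewrite linear0. Qed.

Lemma to_hoch_coboundary n psi : psi \in coboundaries (grp_diff k (cent x)) n ->
  to_hoch gam psi \in coboundaries (hoch_diff k gT) n.
Proof.
case: n psi => [|n] psi; first by rewrite !memv0 => /eqP->; rewrite linear0.
by case/memv_imgP => eta _ ->; rewrite -hoch_diff_to_hoch // memv_img ?memvf.
Qed.

Lemma class_gt0 : (0 < #|(x ^: [set: gT])%g|)%N.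
Proof. by apply/card_gt0P; exists x; apply: class_refl. Qed.

Lemma gam0 : gam (Ordinal class_gt0) = 1%g.
Proof. by case: gamP => -> . Qed.

Lemma coset_cents0 (s : seq (cent x)) :
  coset_cents gam (Ordinal class_gt0) (map val s) = s.
Proof.
elim: s => //= h s IH.
have e : (gam (Ordinal class_gt0) * val h = val h * gam (Ordinal class_gt0))%g.
  by rewrite gam0 mulg1 mul1g.
by have [<- <-] := coset_step_uniq gamP e; rewrite IH.
Qed.

Lemma to_hochK n : cancel (@to_hoch k gT x gam n) (@to_grp k gT x n).
Proof.
move=> psi; apply: seq_ev_inj => s sn; rewrite seq_ev_to_grp //.
have := hcoef_to_hoch gamP psi (Ordinal class_gt0) (s := map val s).
by rewrite size_map gam0 conjg1 coset_cents0 => ->.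
Qed.

(** For a cocycle the tail faces at [x] equal the first face, so [prism_tail_faces] relates [phi] to
    the extension of its restriction. The correction is empty in degree 0. *)
Lemma hcoef_cocycle n (phi : C n) i s : phi \in cocycles (hoch_diff k gT) n ->
  size s = n ->
  hcoef phi (x ^ gam i)%g s =
  hcoef (to_hoch gam (to_grp x phi)) (x ^ gam i)%g s
  + (if s is g :: t then
       prism gam (hcoef phi x) (coset_idx gam i g) t
       - tail_faces (prism gam (hcoef phi x) i) (g :: t)
     else 0).
Proof.
rewrite memv_ker => /eqP phi0 sn.
have dphi0 g t : size t = n -> tail_faces (hcoef phi x) (g :: t) = hcoef phi (x ^ g)%g t.
  by move=> st; apply/esym/subr0_eq; rewrite -hcoef_diff // phi0 hcoef0.
pose G t := if t is a :: t' then hcoef phi (x ^ a)%g t' else 0.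
have prismG : prism gam G i s + tail_faces (prism gam (hcoef phi x) i) s =
    hcoef (to_hoch gam (to_grp x phi)) (x ^ gam i)%g s.
  rewrite hcoef_to_hoch // seq_ev_to_grp; last first.
    by rewrite -sn (eqP (size_coset_cents gam _ (in_tuple s))).
  rewrite -prism_tail_faces //; congr (_ + _); apply: eq_prism => -[//|a t] [st].
  by rewrite dphi0 // st.
case: s sn prismG => [|g t] sn <-; first by rewrite /= !addr0.
(* The leading term of the prism of [G] is the coefficient of [phi] at [x ^ gam i]; in the rest the
   head of the argument lies in C_G(x), so the base point is again [x]. *)
rewrite [prism gam G i _]/= (@eq_prism _ _ _ _ _ (hcoef phi x)) => [|s _]; first by ring.
by rewrite /=; congr (hcoef _ _ _); apply/conjg_fixP/commgP/commute_sym/cent1P/valP.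
Qed.

(** The homotopy K on the summand of [x]; it reads [phi] only at the base point [x]. *)
Definition contraction n (phi : C n.+1) : C n := assemble gam (prism gam (hcoef phi x)) n.

(** Exhibits the correction term of [hcoef_cocycle] as a coboundary. *)
Lemma hcoef_contraction n (phi : C n.+1) i g t : size t = n ->
  hcoef (hoch_diff k gT n (contraction phi)) (x ^ gam i)%g (g :: t) =
  prism gam (hcoef phi x) (coset_idx gam i g) t
  - tail_faces (prism gam (hcoef phi x) i) (g :: t).
Proof.
have prismN j : normalized (prism gam (hcoef phi x) j).
  by apply: prism_normalized => //; apply: hcoef_normalized.
move=> st; rewrite hcoef_diff // -conj_coset_idx // hcoef_assemble //.
congr (_ - _); apply: eq_tail_faces => t' [st'].
by rewrite hcoef_assemble // st' st.
Qed.

End Restriction.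

Lemma to_grp_other (k : fieldType) (gT : finGroupType) n (x y : gT)
    (phi : cochain gT (galg k gT) n) :
  phi \in hoch_part k x n -> y \notin (x ^: [set: gT])%g -> to_grp y phi = 0.
Proof.
move=> phix nyx; apply/ffunP => u.
by rewrite to_grpE (hcoef_part _ phix nyx) ffunE.
Qed.

(** * Assembly over the representatives of the conjugacy classes *)

Section Decomposition.
Variables (k : fieldType) (gT : finGroupType) (X : {set gT}).
Hypothesis hX : is_transversal X (classes [set: gT]) [set: gT].
Variable gam : forall x : gT, 'I_#|(x ^: [set: gT])%g| -> gT.
Arguments gam : clear implicits.
Hypothesis hgam : forall x : gT, x \in X -> right_coset_reps (gam x).
Local Notation T := {x | x \in X}.
Local Notation C := (cochain gT (galg k gT)).
Local Notation Hdsum n := (dsum (fun x : T => Hgrp k (cent (val x)) n)).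

Lemma rep_class_neq (x y : T) : y != x -> val y \notin (val x ^: [set: gT])%g.
Proof.
move=> nyx; have [z _ hz] := class_repP hX (val y).
rewrite hz ?(valP x) //; have := hz _ (valP y); rewrite class_refl => /esym/eqP <-.
by rewrite eq_sym.
Qed.

Lemma cocycle_decomposition n (phi : C n) : phi \in cocycles (hoch_diff k gT) n ->
  phi - \sum_(x : T) to_hoch (gam (val x)) (to_grp (val x) phi)
    \in coboundaries (hoch_diff k gT) n.
Proof.
move=> phiZ.
(* Each [u] lies in the class of exactly one representative, so a single summand contributes to the
   coefficient at [u]. *)
have coefE u s : size s = n -> exists (x : T) i,
    [/\ u = (val x ^ gam (val x) i)%g,
        forall y : T, y != x -> u \notin (val y ^: [set: gT])%g
      & hcoef (phi - \sum_(x : T) to_hoch (gam (val x)) (to_grp (val x) phi)) u s =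
        if s is g :: t then
          prism (gam (val x)) (hcoef phi (val x)) (coset_idx (gam (val x)) i g) t
          - tail_faces (prism (gam (val x)) (hcoef phi (val x)) i) (g :: t)
        else 0].
  move=> sn; have [x0 xX hx] := class_repP hX u.
  pose x : T := Sub x0 xX.
  have ux : u \in (val x ^: [set: gT])%g by rewrite hx ?eqxx.
  have [i ui] := conj_rep_surj (hgam xX) ux.
  have nuy (y : T) : y != x -> u \notin (val y ^: [set: gT])%g.
    by rewrite hx ?(valP y) // -val_eqE.
  exists x, i; split=> //.
  rewrite hcoefB hcoef_sum (big_only1 x) // => [|y nyx _]; last first.
    by rewrite (hcoef_part _ _ (nuy y nyx)) // to_hoch_part //; apply/hgam/valP.
  by rewrite {1}ui (hcoef_cocycle (hgam xX)) // -ui addrC addKr.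
(* In degree 0 there are no coboundaries, and the difference is exactly 0; in positive degree it
   bounds the sum of the contractions. *)
case: n phi phiZ coefE => [|n] phi _ coefE.
  rewrite memv0; apply/eqP/hcoef_inj => u [|//] _.
  by have [x [i [_ _ ->]]] := coefE u [::] erefl; rewrite hcoef0.
suff -> : phi - \sum_(x : T) to_hoch (gam (val x)) (to_grp (val x) phi) =
    \sum_(x : T) hoch_diff k gT n (contraction (gam (val x)) phi).
  by rewrite rpred_sum // => x _; rewrite memv_img ?memvf.
apply: hcoef_inj => u [//|g t] [st].
have [x [i [-> nuy ->]]] := coefE u (g :: t) (congr1 S st).
rewrite hcoef_sum (big_only1 x) // => [|y nyx _].
  by rewrite hcoef_contraction //; apply/hgam/valP.
by rewrite (hcoef_part _ _ (nuy y nyx)) // hoch_part_diff // assemble_part.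
Qed.

(** The cocycle need not be split into components first: the coefficient at [x] sees only the
    component of [x]. *)
Definition HH_to_Hgrp n (q : HH k gT n) : Hdsum n :=
  [ffun x : T => subquot_map (cocycles (grp_diff k (cent (val x))) n)
     (coboundaries (grp_diff k (cent (val x))) n) (@to_grp k gT (val x) n) q].

Definition Hgrp_to_HH n (v : Hdsum n) : HH k gT n :=
  \sum_(x : T) subquot_map (cocycles (hoch_diff k gT) n)
     (coboundaries (hoch_diff k gT) n) (@to_hoch k gT (val x) (gam (val x)) n) (v x).

Lemma HH_to_Hgrp_linear n : linear (@HH_to_Hgrp n).
Proof.
move=> c p q; apply/ffunP => x; rewrite !ffunE; apply: subquot_map_linear.
  by move=> phi; apply: to_grp_cocycle.
by move=> phi; apply: to_grp_coboundary.
Qed.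

HB.instance Definition _ n :=
  GRing.isLinear.Build k (HH k gT n) (Hdsum n) _ (@HH_to_Hgrp n) (@HH_to_Hgrp_linear n).

Lemma Hgrp_to_HH_linear n : linear (@Hgrp_to_HH n).
Proof.
move=> c p q; rewrite /Hgrp_to_HH scaler_sumr -big_split; apply: eq_bigr => x _.
rewrite !ffunE; apply: subquot_map_linear => psi.
  by apply: to_hoch_cocycle; apply/hgam/valP.
by apply: to_hoch_coboundary; apply/hgam/valP.
Qed.

HB.instance Definition _ n :=
  GRing.isLinear.Build k (Hdsum n) (HH k gT n) _ (@Hgrp_to_HH n) (@Hgrp_to_HH_linear n).

(* Bundled here because linearity depends on the hypothesis [hgam]. *)
Definition Hgrp_to_HH_linear_map n : {linear Hdsum n -> HH k gT n} := @Hgrp_to_HH n.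

Lemma HH_to_Hgrp_class n (phi : C n) (x : T) : phi \in cocycles (hoch_diff k gT) n ->
  HH_to_Hgrp (HH_class phi) x = Hgrp_class (to_grp (val x) phi).
Proof.
move=> phiZ; rewrite ffunE; apply: subquot_map_cls phiZ => ?.
  exact: to_grp_cocycle.
exact: to_grp_coboundary.
Qed.

Lemma Hgrp_to_HH_class n (v : Hdsum n)
    (psi : forall x : T, cochain (cent (val x)) k^o n) :
  (forall x, psi x \in cocycles (grp_diff k (cent (val x))) n) ->
  (forall x, v x = Hgrp_class (psi x)) ->
  Hgrp_to_HH v = HH_class (\sum_(x : T) to_hoch (gam (val x)) (psi x)).
Proof.
move=> psiZ vE; rewrite /HH_class linear_sum; apply: eq_bigr => x _; rewrite vE.
apply: subquot_map_cls (psiZ x) => eta.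
  by apply: to_hoch_cocycle; apply/hgam/valP.
by apply: to_hoch_coboundary; apply/hgam/valP.
Qed.

Lemma HH_to_HgrpK n : cancel (@HH_to_Hgrp n) (@Hgrp_to_HH n).
Proof.
move=> q; have [phi phiZ ->] := subquot_cls_surj q.
rewrite (Hgrp_to_HH_class (psi := fun x => to_grp (val x) phi)); first last.
- by move=> x; apply: HH_to_Hgrp_class.
- by move=> x; apply: to_grp_cocycle.
apply/esym/cls_eq => //; last exact: cocycle_decomposition.
rewrite rpred_sum // => x _; apply/to_hoch_cocycle/to_grp_cocycle => //.
exact/hgam/valP.
Qed.

(** Restriction at [y] kills the extensions from other classes by their support, and undoes the one
    from [y] already on cochains. *)
Lemma Hgrp_to_HHK n : cancel (@Hgrp_to_HH n) (@HH_to_Hgrp n).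
Proof.
move=> v.
have [psi psiZ vE] := fin_all_exists2 (fun x => subquot_cls_surj (v x)).
rewrite (Hgrp_to_HH_class psiZ vE); apply/ffunP => y.
rewrite HH_to_Hgrp_class; last first.
  by rewrite rpred_sum // => x _; apply: to_hoch_cocycle (psiZ x); apply/hgam/valP.
suff -> : to_grp (val y) (\sum_(x : T) to_hoch (gam (val x)) (psi x)) = psi y.
  by rewrite vE.
rewrite (linear_sum (@to_grp k gT (val y) n)).
rewrite (@big_only1 _ _ _ _ y) // => [|x nxy _].
  by apply: to_hochK; apply/hgam/valP.
apply: to_grp_other (rep_class_neq _).
  by apply: to_hoch_part; apply/hgam/valP.
by rewrite eq_sym.
Qed.

Lemma dsum_inj_other n (x y : T) (c : Hgrp k (cent (val x)) n) :
  y != x -> (dsum_inj c : Hdsum n) y = 0.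
Proof. by move=> nyx; rewrite ffunE dfwith_out // eq_sym. Qed.

Lemma dsum_inj_same n (x : T) (c : Hgrp k (cent (val x)) n) :
  (dsum_inj c : Hdsum n) x = c.
Proof. by rewrite ffunE dfwith_in. Qed.

Lemma HH_to_Hgrp_part n (x : T) (phi : C n) :
  phi \in hoch_part k (val x) n -> phi \in cocycles (hoch_diff k gT) n ->
  HH_to_Hgrp (HH_class phi) = dsum_inj (i := x) (Hgrp_class (to_grp (val x) phi)).
Proof.
move=> phix phiZ; apply/ffunP => y; rewrite HH_to_Hgrp_class //.
have [->|nyx] := eqVneq y x; first by rewrite dsum_inj_same.
rewrite dsum_inj_other // (to_grp_other phix) ?rep_class_neq //.
exact: (linear0 (cls _ _)).
Qed.

End Decomposition.

Theorem theorem6p3 (k : fieldType) (gT : finGroupType) (X : {set gT})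
    (hX : is_transversal X (classes [set: gT]) [set: gT])
    (gam : forall x : gT, 'I_#|(x ^: [set: gT])%g| -> gT)
    (hgam : forall x : gT, x \in X -> right_coset_reps (gam x)) :
  exists
    (Phi : forall n,
      {linear HH k gT n -> dsum (fun x : {x | x \in X} => Hgrp k (cent (val x)) n)})
    (Psi : forall n,
      {linear dsum (fun x : {x | x \in X} => Hgrp k (cent (val x)) n) -> HH k gT n}),
  [/\ forall n, cancel (Phi n) (Psi n) /\ cancel (Psi n) (Phi n),
      forall n (x : {x | x \in X}) (phi : cochain gT (galg k gT) n),
        phi \in hoch_part k (val x) n ->
        phi \in cocycles (hoch_diff k gT) n ->
        [/\ forall h : nbar (cent (val x)) n,
              untwist phi (val h) \in kspan k (val x ^: [set: gT])%g,
            to_grp (val x) phi \in cocycles (grp_diff k (cent (val x))) n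
          & Phi n (HH_class phi) = dsum_inj (i := x) (Hgrp_class (to_grp (val x) phi))]
    & forall n (x : {x | x \in X}) (psi : cochain (cent (val x)) k^o n),
        psi \in cocycles (grp_diff k (cent (val x))) n ->
        [/\ to_hoch (gam (val x)) psi \in hoch_part k (val x) n,
            to_hoch (gam (val x)) psi \in cocycles (hoch_diff k gT) n
          & Psi n (dsum_inj (i := x) (Hgrp_class psi)) = HH_class (to_hoch (gam (val x)) psi)]].
Proof.
exists (fun n => @HH_to_Hgrp k gT X n), (Hgrp_to_HH_linear_map k hgam).
split=> [n|n x phi phix phiZ|n x psi psiZ].
- by split; [apply: (HH_to_HgrpK hX hgam) | apply: (Hgrp_to_HHK hX hgam)].
- split=> [h||]; [|exact: to_grp_cocycle|exact: (HH_to_Hgrp_part hX)].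
  by apply/kspanP => u nu; rewrite untwistE (hcoef_part _ phix).
- have gamP := hgam _ (valP x).
  have to_hochZ := to_hoch_cocycle gamP psiZ.
  split=> //; first exact: to_hoch_part.
  (* Writing [psi] as the restriction of its own extension turns the left side into a value of the
     composite of both maps. *)
  rewrite -[psi in LHS](to_hochK gamP) -(HH_to_Hgrp_part hX) ?to_hoch_part //.
  exact: (HH_to_HgrpK hX hgam).
Qed.
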